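(* For every matrix $A\in\mathbb R_{\ge0}^{n\times n}$ and every directed tree $T$ on $k$ vertices, $$\hom(T,A)\;\le\;\max\Big\{\sum_{i=1}^n c_i^{k-1},\ \sum_{i=1}^n r_i^{k-1}\Big\}.$$
   Context: A directed tree is an orientation of a finite undirected tree. For a nonnegative matrix $A=(A_{ij})\in\mathbb R_{\ge0}^{n\times n}$, $r_i:=\sum_jA_{ij}$ are the row sums and $c_i:=\sum_jA_{ji}$ the column sums, and $$\hom(T,A):=\sum_{\varphi:V(T)\to[n]}\ \prod_{(u\to v)\in E(T)}A_{\varphi(u)\varphi(v)},$$ the sum running over all maps from $V(T)$ to $[n]=\{1,\dots,n\}$. Convention: $0^0=1$. *)

(* Defs.v *)
From mathcomp Require Import all_boot all_order all_algebra.
From mathcomp Require Import reals.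

Set Implicit Arguments.
Unset Strict Implicit.
Unset Printing Implicit Defensive.

Import Order.TTheory GRing.Theory Num.Theory.
Local Open Scope ring_scope.

Definition simple_graph (V : finType) (e : rel V) : Prop :=
  symmetric e /\ irreflexive e.

Definition connected_graph (V : finType) (e : rel V) : Prop :=
  (0 < #|V|)%N /\ forall x y : V, connect e x y.

(* The bound on the size is needed because [ucycle e] also accepts [::] and,
   for every edge xy, the degenerate cycle [:: x; y]. *)
Definition acyclic_graph (V : finType) (e : rel V) : Prop :=
  forall p : seq V, (2 < size p)%N -> ~ ucycle e p.

Definition tree (V : finType) (e : rel V) : Prop :=
  [/\ simple_graph e, connected_graph e & acyclic_graph e].

(* Each edge xy of e is given exactly one of the directions x -> y, y -> x. *)
Definition orientation (V : finType) (e d : rel V) : Prop :=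
  (forall x y : V, e x y = d x y || d y x) /\
  (forall x y : V, ~~ (d x y && d y x)).

Definition directed_tree (V : finType) (d : rel V) : Prop :=
  exists e : rel V, tree e /\ orientation e d.

Definition row_sum (R : realType) (n : nat) (A : 'M[R]_n) (i : 'I_n) : R :=
  \sum_(j < n) A i j.

Definition col_sum (R : realType) (n : nat) (A : 'M[R]_n) (i : 'I_n) : R :=
  \sum_(j < n) A j i.

Definition digraph_hom (R : realType) (V : finType) (d : rel V) (n : nat)
    (A : 'M[R]_n) : R :=
  \sum_(phi : {ffun V -> 'I_n})
     \prod_(uv : V * V | d uv.1 uv.2) A (phi uv.1) (phi uv.2).

(* Main.v *)
Require Import Defs.
From mathcomp Require Import all_boot all_order all_algebra.
From mathcomp Require Import reals.
From mathcomp Require Import ring.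

Set Implicit Arguments.
Unset Strict Implicit.
Unset Printing Implicit Defensive.

Import Order.TTheory GRing.Theory Num.Theory.
Local Open Scope ring_scope.

(** The idea is to prune the tree leaf by leaf while carrying a power of a
    row or column sum at one marked vertex.  Fix a tree with a marked vertex v
    and consider the sum over all maps phi of the edge product times
    x(phi v)^a, where x is one of the two sum functions r, c.  If the tree has
    at least two vertices, it has a leaf u other than v; summing over the
    value of phi at u replaces the edge between u and its neighbour w by a
    factor y(phi w), where y is r or c according to the direction of the edge.
    The weighted arithmetic-geometric inequality
    [(a + 1) x^a y <= a x^(a+1) + y^(a+1)]
    bounds the result by a convex combination of two sums of the same kind for
    the tree without u, with exponent a + 1: one marked at v, one marked at w.
    By induction (lemma [marked_hom_le]) both are at most the maximum of
    [\sum_i c_i^m] and [\sum_i r_i^m], where m is the initial exponent plus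
    the number of edges; once a single vertex is left, the marked sum is one
    of these two quantities.  The theorem is the case a = 0.

    Subtrees are represented by connected vertex sets S of the given tree, and
    the maps phi stay defined on the whole vertex set.  A marked sum for S
    then counts each map on S once for every extension to the other vertices,
    hence the powers of n in the statements. *)

(** * An arithmetic-geometric inequality *)

Lemma exp_mul_le_mean (R : realDomainType) (a : nat) (x y : R) :
  0 <= x -> 0 <= y ->
  a.+1%:R * (x ^+ a * y) <= a%:R * x ^+ a.+1 + y ^+ a.+1.
Proof.
move=> x0 y0; elim: a => [|a IHa]; first by rewrite mul0r add0r !mul1r !expr1.
(* The inequality for a + 1 is y times the inequality for a, plus the
   nonnegative term (a + 1) x^a (x - y)^2. *)
have IHy := ler_wpM2r y0 IHa.
have sq : 0 <= a.+1%:R * (x ^+ a * (x - y) ^+ 2).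
  by rewrite mulr_ge0 ?ler0n // mulr_ge0 ?sqr_ge0 ?exprn_ge0.
rewrite -subr_ge0; rewrite -subr_ge0 in IHy.
apply: le_trans (addr_ge0 IHy sq) _.
by rewrite le_eqVlt; apply/orP; left; apply/eqP; rewrite !exprS -!natr1; ring.
Qed.

(** * Pruning a leaf of a tree *)

Definition induced (V : finType) (e : rel V) (S : {set V}) : rel V :=
  [rel x y | [&& x \in S, y \in S & e x y]].

Definition connected_set (V : finType) (e : rel V) (S : {set V}) : bool :=
  [forall x in S, forall y in S, connect (induced e S) x y].

Lemma connected_setP (V : finType) (e : rel V) (S : {set V}) :
  reflect {in S &, forall x y, connect (induced e S) x y} (connected_set e S).
Proof.
apply: (iffP forall_inP) => [H x y xS yS | H x xS].
  by move/forall_inP: (H x xS); apply.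
by apply/forall_inP => y yS; apply: H.
Qed.

Lemma connect_crossing (V : finType) (r : rel V) (X : {set V}) (x y : V) :
  connect r x y -> x \in X -> y \notin X ->
  exists a b, [/\ a \in X, b \notin X & r a b].
Proof.
case/connectP=> p; elim: p x => [|z p IHp] x /= => [_ -> ->//|].
case/andP=> rxz pth defy xX yX.
have [zX|zX] := boolP (z \in X); first exact: (IHp z).
by exists x, z.
Qed.

Lemma connected_setU1 (V : finType) (e : rel V) (X : {set V}) (x u : V) :
  symmetric e -> connected_set e X -> x \in X -> e x u ->
  connected_set e (u |: X).
Proof.
move=> sym_e /connected_setP conX xX exu.
have csym : connect_sym (induced e (u |: X)).
  by apply: sym_connect_sym => a b; rewrite /induced /= sym_e andbCA.
have to_x z : z \in u |: X -> connect (induced e (u |: X)) x z.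
  case/setU1P=> [->|zX].
    by apply: connect1; rewrite /induced /= !inE eqxx xX exu orbT.
  apply: connect_sub (conX _ _ xX zX) => a b /= /and3P[aX bX eab].
  by apply: connect1; rewrite /induced /= !inE aX bX eab !orbT.
apply/connected_setP => y z yX zX.
by apply: connect_trans (to_x z zX); rewrite csym to_x.
Qed.

(** Two neighbours of u in a connected set avoiding u would close a cycle
    through u. *)
Lemma acyclic_neighbor_unique (V : finType) (e : rel V) (X : {set V})
    (u x y : V) :
  symmetric e -> acyclic_graph e -> connected_set e X -> u \notin X ->
  x \in X -> y \in X -> e x u -> e y u -> x = y.
Proof.
move=> sym_e acy /connected_setP conX uX xX yX exu eyu.
apply/eqP; apply: contraT => neq_xy.
have /connectP[p0 pth0 last0] := conX x y xX yX.
move: last0; case/shortenP: pth0 => p pth uniq_p _ lastp.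
have pX z : z \in p -> z \in X.
  move: pth; elim: p x {xX exu neq_xy uniq_p lastp} => //= t p IHp x.
  case/andP=> /and3P[_ tX _] pth; rewrite inE => /orP[/eqP->//|].
  exact: IHp pth.
case: (acy (u :: x :: p)).
  by case: p lastp {pth uniq_p pX} => //= eq_yx; rewrite eq_yx eqxx in neq_xy.
rewrite /ucycle /= rcons_path -lastp sym_e exu eyu andbT.
move: uniq_p => /= ->; rewrite inE negb_or !andbT; apply/and3P; split.
- by apply: sub_path pth => a b /= /and3P[].
- by apply: contraNneq uX => ->.
- by apply: contra uX; apply: pX.
Qed.

(** The leaf is the vertex missed by a maximal proper connected subset that
    contains v: such a subset has an edge leaving it inside S, and by
    maximality the endpoint of that edge is all that is missing. *)
Lemma exists_leaf_neq (V : finType) (e : rel V) (S : {set V}) (v : V) :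
  symmetric e -> acyclic_graph e -> connected_set e S -> v \in S ->
  (1 < #|S|)%N ->
  exists u w X, [/\ S = u |: X, u \notin X, v \in X & connected_set e X] /\
                [/\ w \in X, e w u & forall z, z \in X -> e z u -> z = w].
Proof.
move=> sym_e acy conS vS S_gt1.
pose P (X : {set V}) := [&& v \in X, X \proper S & connected_set e X].
have Pv : P [set v].
  rewrite /P set11 properEcard sub1set vS cards1 S_gt1 /=.
  by apply/connected_setP => x y /set1P-> /set1P->.
have [X /maxsetP[/and3P[vX ltXS conX] maxX] _] := maxset_exists Pv.
have [sXS [y yS yX]] := properP ltXS.
have [w [u [wX uX /and3P[_ uS ewu]]]] :=
  connect_crossing (connected_setP _ _ conS v y vS yS) vX yX.
exists u, w, X; split; last first.
  split=> // z zX ezu.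
  exact: (acyclic_neighbor_unique sym_e acy conX uX).
split=> //; apply/eqP; rewrite eq_sym; apply: contraT => neqS.
have PuX : P (u |: X).
  rewrite /P setU1r // (connected_setU1 sym_e conX wX ewu) andbT.
  by rewrite properEneq neqS subUset sub1set uS.
by rewrite -(maxX _ PuX (subsetUr _ _)) setU11 in uX.
Qed.

(** * Summing out the value at one vertex *)

Definition ffun_update (V : finType) (T : Type) (phi : {ffun V -> T})
  (u : V) (t : T) : {ffun V -> T} := [ffun x => if x == u then t else phi x].

(** Exchanging the value of phi at u with j is an involution on the pairs
    (phi, j). *)
Lemma sum_ffun_at (R : pzSemiRingType) (V J : finType) (u : V)
    (F : {ffun V -> J} -> J -> R) :
  (forall phi t, F (ffun_update phi u t) =1 F phi) ->
  #|J|%:R * (\sum_phi F phi (phi u)) = \sum_phi \sum_j F phi j.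
Proof.
move=> Fu; rewrite mulr_natl -sumr_const exchange_big /=.
pose swap (q : {ffun V -> J} * J) := (ffun_update q.1 u q.2, q.1 u).
have swapK : involutive swap.
  case=> phi j; rewrite /swap /= ffunE eqxx; congr pair.
  by apply/ffunP=> x; rewrite !ffunE; case: eqVneq => [->|].
rewrite !pair_bigA /= (reindex_inj (inv_inj swapK)) /=.
by apply: eq_bigr => -[phi j] _ /=; rewrite Fu ffunE eqxx.
Qed.

(** * Homomorphism sums with a marked vertex *)

Section MarkedHom.

Variables (R : realType) (n : nat) (A : 'M[R]_n) (V : finType).
Hypothesis A_ge0 : forall i j, 0 <= A i j.

Definition edge_prod (d : rel V) (S : {set V}) (phi : {ffun V -> 'I_n}) : R :=
  \prod_(uv : V * V | [&& d uv.1 uv.2, uv.1 \in S & uv.2 \in S])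
     A (phi uv.1) (phi uv.2).

Definition line_sum (out : bool) (i : 'I_n) : R :=
  if out then row_sum A i else col_sum A i.

Definition star_bound (m : nat) : R :=
  Num.max (\sum_i col_sum A i ^+ m) (\sum_i row_sum A i ^+ m).

Lemma edge_prod_ge0 d S phi : 0 <= edge_prod d S phi.
Proof. exact: prodr_ge0. Qed.

Lemma line_sum_ge0 b i : 0 <= line_sum b i.
Proof. by case: b; apply: sumr_ge0. Qed.

Lemma sum_line_sum_le b m : \sum_i line_sum b i ^+ m <= star_bound m.
Proof. by rewrite le_max; case: b => /=; rewrite lexx ?orbT. Qed.

Lemma edge_prod_update d (S : {set V}) (u : V) phi t :
  u \notin S -> edge_prod d S (ffun_update phi u t) = edge_prod d S phi.
Proof.
move=> uS; apply: eq_bigr => -[x y] /= /and3P[_ xS yS]; rewrite !ffunE.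
have neq z : z \in S -> (z == u) = false.
  by move=> zS; apply: contraNF uS => /eqP <-.
by rewrite !neq.
Qed.

Lemma edge_prod_leaf (d e : rel V) (X : {set V}) (u w : V) phi :
  irreflexive e -> symmetric e -> orientation e d ->
  u \notin X -> w \in X -> e w u ->
  (forall z, z \in X -> e z u -> z = w) ->
  edge_prod d (u |: X) phi =
    edge_prod d X phi * (if d w u then A (phi w) (phi u)
                         else A (phi u) (phi w)).
Proof.
move=> irr sym_e [ed dd] uX wX ewu uniq_w.
have neq_wu : (w == u) = false by apply: contraNF uX => /eqP <-.
have de x y : d x y -> e x y by rewrite ed => ->.
pose uv0 := if d w u then (w, u) else (u, w).
have duv0 : d uv0.1 uv0.2.
  by move: ewu; rewrite /uv0 ed; case: (boolP (d w u)) => [|_] /=.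
rewrite /edge_prod (bigD1 uv0) /=; last first.
  by rewrite duv0 /uv0; case: ifP => _; rewrite !inE !eqxx wX ?orbT.
rewrite mulrC; congr (_ * _); last by rewrite /uv0; case: ifP.
apply: eq_bigl => -[x y] /=; rewrite !inE.
have [dxy|//] := boolP (d x y); rewrite /=.
have [xu|xu] := eqVneq x u; have [yu|yu] := eqVneq y u; rewrite /=.
- by move: (de _ _ dxy); rewrite xu yu irr.
- rewrite xu (negbTE uX) /=; apply/negP => /andP[yX].
  have yw : y = w by apply: uniq_w; rewrite // sym_e de // -xu.
  move: (dd x y); rewrite dxy xu yw /uv0 => /= /negbTE ->.
  by rewrite eqxx.
- rewrite yu (negbTE uX) andbF andbT; apply/negP => /andP[xX].
  have xw : x = w by apply: uniq_w; rewrite // de // -yu.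
  by move: dxy; rewrite /uv0 xw yu => ->; rewrite eqxx.
- suff -> : (x, y) != uv0 by rewrite andbT.
  rewrite /uv0; case: ifP => _; rewrite xpair_eqE negb_and ?xu ?yu ?orbT //.
Qed.

Definition marked_hom (d : rel V) (S : {set V}) (f : 'I_n -> R) (v : V) : R :=
  \sum_phi edge_prod d S phi * f (phi v).

Lemma marked_hom_set1 (d : rel V) (f : 'I_n -> R) (v : V) :
  irreflexive d -> n%:R * marked_hom d [set v] f v = n%:R ^+ #|V| * \sum_i f i.
Proof.
move=> irr; have prod1 phi : edge_prod d [set v] phi = 1.
  rewrite /edge_prod big_pred0 // => -[x y] /=.
  by apply/and3P=> -[dxy /set1P xv /set1P yv]; rewrite xv yv irr in dxy.
have -> : marked_hom d [set v] f v = \sum_(phi : {ffun V -> 'I_n}) f (phi v).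
  by apply: eq_bigr => phi _; rewrite prod1 mul1r.
rewrite -[n in n%:R]card_ord (@sum_ffun_at _ _ _ v (fun=> f)) //.
by rewrite sumr_const card_ffun -natrX mulr_natl.
Qed.

(** The two powers on the right sit at single vertices, which is what lets the
    induction continue after a leaf has left a factor at w. *)
Lemma marked_hom_le_mean (d : rel V) (S : {set V}) (b c : bool) (a : nat)
    (v w : V) :
  a.+1%:R * (\sum_phi edge_prod d S phi *
               (line_sum b (phi v) ^+ a * line_sum c (phi w))) <=
  a%:R * marked_hom d S (fun i => line_sum b i ^+ a.+1) v +
  marked_hom d S (fun i => line_sum c i ^+ a.+1) w.
Proof.
rewrite !mulr_sumr -big_split /=; apply: ler_sum => phi _.
rewrite mulrCA [X in X + _]mulrCA -mulrDr.
by rewrite ler_wpM2l ?edge_prod_ge0 // exp_mul_le_mean ?line_sum_ge0.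
Qed.

Lemma marked_hom_leaf (d e : rel V) (X : {set V}) (u w v : V)
    (f : 'I_n -> R) :
  irreflexive e -> symmetric e -> orientation e d ->
  u \notin X -> v \in X -> w \in X -> e w u ->
  (forall z, z \in X -> e z u -> z = w) ->
  n%:R * marked_hom d (u |: X) f v =
  \sum_phi edge_prod d X phi * (f (phi v) * line_sum (d w u) (phi w)).
Proof.
move=> irr sym_e od uX vX wX ewu uniq_w.
pose F (phi : {ffun V -> 'I_n}) j :=
  edge_prod d X phi *
  (f (phi v) * (if d w u then A (phi w) j else A j (phi w))).
have -> : marked_hom d (u |: X) f v = \sum_phi F phi (phi u).
  apply: eq_bigr => phi _.
  rewrite (edge_prod_leaf phi irr sym_e od uX wX ewu uniq_w) /F.
  by rewrite mulrAC mulrA.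
rewrite -[n in n%:R]card_ord (@sum_ffun_at _ _ _ u F); last first.
  move=> phi t j; rewrite /F edge_prod_update // !ffunE.
  have neq z : z \in X -> (z == u) = false.
    by move=> zX; apply: contraNF uX => /eqP <-.
  by rewrite !neq.
apply: eq_bigr => phi _; rewrite /F -!mulr_sumr /line_sum.
by case: (d w u).
Qed.

(** The marked vertex changes when a leaf is pruned, so the induction ranges
    over all marks, exponents and both kinds of sums at once. *)
Lemma marked_hom_le (d e : rel V) (s a : nat) (b : bool) (S : {set V})
    (v : V) :
  irreflexive e -> symmetric e -> acyclic_graph e -> orientation e d ->
  connected_set e S -> v \in S -> #|S| = s.+1 ->
  n%:R ^+ s.+1 * marked_hom d S (fun i => line_sum b i ^+ a) v <=
  n%:R ^+ #|V| * star_bound (a + s).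
Proof.
move=> irr sym_e acy od.
have irr_d : irreflexive d.
  by move=> x; apply/negbTE; case: od => _ /(_ x x); rewrite andbb.
elim: s a b S v => [|s IHs] a b S v conS vS cardS.
  move/eqP/cards1P: cardS vS => [x ->] /set1P->; rewrite expr1 addn0.
  rewrite marked_hom_set1 // ler_wpM2l ?exprn_ge0 ?ler0n //.
  exact: sum_line_sum_le.
have S_gt1 : (1 < #|S|)%N by rewrite cardS.
have [u [w [X [[defS uX vX conX] [wX ewu uniq_w]]]]] :=
  exists_leaf_neq sym_e acy conS vS S_gt1.
have cardX : #|X| = s.+1 by move: cardS; rewrite defS cardsU1 uX => -[].
rewrite defS exprSr -mulrA.
rewrite (marked_hom_leaf _ irr sym_e od uX vX wX ewu uniq_w).
(* The factor a + 1 clears the denominator of the convex combination. *)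
rewrite -(@ler_pM2l _ a.+1%:R) ?ltr0n // mulrCA.
apply: le_trans (ler_wpM2l _ (marked_hom_le_mean _ _ _ _ _ _ _)) _.
  by rewrite exprn_ge0 ?ler0n.
rewrite mulrDr mulrCA -natr1 mulrDl mul1r addnS -addSn.
by rewrite lerD ?ler_wpM2l ?ler0n ?IHs.
Qed.

End MarkedHom.

Theorem corollary5p6 (R : realType) (n : nat) (A : 'M[R]_n)
    (k : nat) (V : finType) (d : rel V) :
  (forall i j : 'I_n, 0 <= A i j) ->
  directed_tree d ->
  #|V| = k ->
  digraph_hom d A <= Num.max (\sum_(i < n) col_sum A i ^+ (k - 1))
                     (\sum_(i < n) row_sum A i ^+ (k - 1)).
Proof.
move=> A_ge0 [e [[[sym_e irr] [V_gt0 conV] acy] od]] <-.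
have /card_gt0P[v _] := V_gt0.
(* The factor n^k has to be cancelled at the end; if n = 0 there are no maps,
   since V is nonempty. *)
case: n A A_ge0 => [|n] A A_ge0.
  rewrite /digraph_hom big1 ?big_ord0 ?maxxx // => phi.
  by case: (phi v).
have conT : connected_set e [set: V].
  apply/connected_setP => x y _ _.
  by rewrite (@eq_connect _ _ e) // => a b; rewrite /induced /= !inE.
have cardT : #|[set: V]| = (#|V| - 1).+1 by rewrite cardsT subn1 prednK.
have := marked_hom_le A_ge0 0 true irr sym_e acy od conT (in_setT v) cardT.
rewrite add0n -cardT cardsT ler_pM2l ?exprn_gt0 ?ltr0n //.
congr (_ <= _); apply: eq_bigr => phi _; rewrite expr0 mulr1.
by apply: eq_bigl => uv; rewrite !inE !andbT.
Qed.
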